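(* Let $\mathcal H$ be a separable real Hilbert space, $\mathcal J:\mathcal H\to\mathbb R$ a continuous linear function, and let $P\subset\mathcal H$ be nonempty, bounded, convex, and closed in $\mathcal H$. Then the problem of finding $\dot k\in P$ such that $$\mathcal J(\dot k)=\max_{\dot h\in P}\mathcal J(\dot h)$$ has at least one solution. *)

(* Defs.v *)
From HB Require Import structures.
From mathcomp Require Import all_boot all_order all_algebra sesquilinear.
From mathcomp Require Import all_classical all_reals all_analysis.

Set Implicit Arguments.
Unset Strict Implicit.
Unset Printing Implicit Defensive.

Import Order.TTheory GRing.Theory Num.Theory.
Import numFieldNormedType.Exports.

Local Open Scope classical_set_scope.
Local Open Scope ring_scope.

(* A real Hilbert space is a complete normed space together with an inner
   product (a form [{dot H for idfun}]: bilinear, symmetric, positive definite)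
   whose induced norm is the norm of the space. *)
Definition induces_norm (R : realType) (H : normedModType R)
    (ip : {dot H for idfun}) : Prop :=
  forall x : H, `|x| = Num.sqrt (ip x x).

Definition separable (T : topologicalType) : Prop :=
  exists2 D : set T, countable D & dense D.

(* [m] is the greatest element of [A], i.e. the maximum of [A] is attained and
   equal to [m]. *)
Definition is_max (R : realType) (A : set R) (m : R) : Prop :=
  A m /\ ubound A m.

(* Main.v *)
(* With M = sup J(P), let D be the limit, as c increases to M, of the infimum of
   |x|^2 over the convex slices {x in P | c <= J x}.  Points u_n of P with
   M - 1/(n+1) <= J u_n and |u_n|^2 < D + 1/(n+1) form a Cauchy sequence: the
   midpoint of two late terms lies in a slice where |x|^2 > D - d, so by the
   parallelogram law the terms are close.  The limit lies in P and attains M;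
   no weak compactness is needed. *)
Require Import Defs.
From HB Require Import structures.
From mathcomp Require Import all_boot all_order all_algebra sesquilinear.
From mathcomp Require Import all_classical all_reals all_analysis.
From mathcomp Require Import ring lra.

Set Implicit Arguments.
Unset Strict Implicit.
Unset Printing Implicit Defensive.

Import Order.TTheory GRing.Theory Num.Theory.
Import numFieldNormedType.Exports.

Local Open Scope classical_set_scope.
Local Open Scope ring_scope.

Lemma parallelogram (R : realType) (H : normedModType R)
    (ip : {dot H for idfun}) (ip_norm : induces_norm ip) (x y : H) :
  `|x - y| ^+ 2 + `|x + y| ^+ 2 = (`|x| ^+ 2 + `|y| ^+ 2) *+ 2.
Proof.
(* Removing the square root requires [ip z z] to be nonnegative; definiteness gives this for nonzero
   [z], so zero is treated apart. *)
have ipE z : `|z| ^+ 2 = ip z z.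
  rewrite ip_norm sqr_sqrtr//; have [->|z0] := eqVneq z 0.
    by rewrite linear0l.
  exact/ltW/neq0_dnorm_gt0.
rewrite !ipE linearBl linearDl !linearBr !linearDr.
ring.
Qed.

Lemma convex_set_midpoint (R : realType) (M : lmodType R) (P : set M) (x y : M) :
  convex_set P -> P x -> P y -> P (2^-1 *: (x + y)).
Proof.
move=> Pconv Px Py.
(* The weights in [convex_set] live in an interval type, so [2^-1] must be bundled with a proof that
   it lies in [0, 1]. *)
have half01 : Itv.spec (@Itv.num_sem R) (Itv.Real `[0%Z, 1%Z]) (2^-1 : R).
  by apply/and3P; split=> //=; rewrite ?num_real ?bnd_simp; lra.
have := Pconv x y (Itv.mk half01) (mem_set Px) (mem_set Py).
rewrite inE /conv/= /unstable.onem.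
have -> : 1 - 2^-1 = 2^-1 :> R by lra.
by rewrite -scalerDr.
Qed.

Lemma bounded_set_scalar (R : realType) (H : normedModType R) (J : {scalar H})
    (P : set H) :
  continuous J -> bounded_set P -> has_ubound [set J h | h in P].
Proof.
move=> Jcont /(pinfty_ex_gt (@real0 R)) [K _ PK].
(* Viewing the target as the normed module [R^o] makes [linear_boundedP] applicable. *)
pose f : {linear H -> R^o} := J.
have /linear_bounded_continuous/linear_boundedP : continuous f := Jcont.
move=> /(pinfty_ex_gt (@real0 R)) [r r0 Jr].
exists (r * K) => _ [x Px <-].
rewrite (le_trans (ler_norm _))// (le_trans (Jr x))//.
by apply: ler_wpM2l; [exact: ltW|exact: PK].
Qed.

(* [D] is the limit, as [c] increases to [M], of the infimum of [g] over the
   slice [P `&` [set x | c <= f x]]. *)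
Lemma slice_infimum_limit (R : realType) (T : Type) (P : set T) (f g : T -> R)
    (M K : R) :
  (forall c, c < M -> exists2 x, P x & c <= f x) ->
  (forall x, P x -> 0 <= g x <= K) ->
  exists D : R, forall e, 0 < e ->
    (exists2 c, c < M & forall x, P x -> c <= f x -> D - e < g x) /\
    (forall c, c < M -> exists x, [/\ P x, c <= f x & g x < D + e]).
Proof.
move=> slice0 gK.
(* All lower bounds of [g] on some slice are collected: as the slice infima increase with [c],
   [sup S] is their limit. *)
pose S := [set d | exists2 c, c < M & forall x, P x -> c <= f x -> d <= g x].
have supS : has_sup S.
  split.
    by exists 0, (M - 1) => [|x /gK /andP[]//]; lra.
  exists K => d [c cM dg]; have [x Px cx] := slice0 _ cM.
  by rewrite (le_trans (dg _ Px cx))//; case/andP: (gK _ Px).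
exists (sup S) => e e0; split.
  have [d [c cM dg] ltd] := sup_adherent e0 supS.
  by exists c => // x Px cx; rewrite (lt_le_trans ltd)// dg.
move=> c cM; apply/not_existsP => noslice.
(* With no such point in the slice at [c], [sup S + e] would itself be a lower bound of [g] there,
   hence a member of [S]. *)
have /(sup_upper_bound supS) : S (sup S + e); last lra.
exists c => // x Px cx; rewrite leNgt; apply/negP => gx.
exact: noslice x (And3 Px cx gx).
Qed.

Lemma closed_convex_slices_meet (R : realType) (H : completeNormedModType R)
    (ip : {dot H for idfun}) (ip_norm : induces_norm ip)
    (J : {scalar H}) (J_continuous : continuous J)
    (P : set H) (P_bounded : bounded_set P)
    (P_convex : convex_set P) (P_closed : closed P) (M : R) :
  (forall c, c < M -> exists2 x, P x & c <= J x) ->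
  exists2 k, P k & M <= J k.
Proof.
move=> slice0; have /(pinfty_ex_gt (@real0 R)) [K _ PK] := P_bounded.
have normK x : P x -> 0 <= `|x| ^+ 2 <= K ^+ 2.
  by move=> Px; rewrite sqr_ge0 lerXn2r// ?nnegrE ?(le_trans _ (PK _ Px)) ?PK.
have [D DP] := slice_infimum_limit slice0 normK.
(* The same 1/(n+1) serves as gap below [M] and as tolerance above [D]. *)
have /choice [u uP] : forall n : nat, exists x, [/\ P x, M - n.+1%:R^-1 <= J x &
    `|x| ^+ 2 < D + n.+1%:R^-1].
  move=> n; have n0 : 0 < n.+1%:R^-1 :> R by rewrite invr_gt0.
  by apply: (DP _ n0).2; rewrite ltrBlDr ltrDl.
have /cauchy_cvgP/cvg_ex [k uk] : cauchy (u @ \oo).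
  apply/cauchy_ballP => e e0.
  (* By the parallelogram law, |x - y|^2 = 2|x|^2 + 2|y|^2 - 4|(x + y)/2|^2 < 4(D + d) - 4(D - d) =
     8d, which is e^2. *)
  pose d : R := e ^+ 2 / 8.
  have d0 : 0 < d by rewrite divr_gt0 ?exprn_gt0.
  have [c cM cD] := (DP d d0).1.
  have Mc0 : 0 < M - c by rewrite subr_gt0.
  have Pc : \forall n \near \oo,
      [/\ P (u n), c <= J (u n) & `|u n| ^+ 2 < D + d].
    near=> n.
    have [Pn Jn nn] := uP n.
    have nd : n.+1%:R^-1 < d.
      by near: n; exact: (near_infty_natSinv_lt (PosNum d0)).
    have nc : n.+1%:R^-1 < M - c.
      by near: n; exact: (near_infty_natSinv_lt (PosNum Mc0)).
    split=> //; first by rewrite (le_trans _ Jn)// lerBrDl -lerBrDr ltW.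
    by rewrite (lt_trans nn)// ltrD2l.
  near=> x y.
  have [Px cx xD] : [/\ P x, c <= J x & `|x| ^+ 2 < D + d] by near: x.
  have [Py cy yD] : [/\ P y, c <= J y & `|y| ^+ 2 < D + d] by near: y.
  rewrite -ball_normE /ball_/= -(@ltr_pXn2r _ 2)// ?nnegrE// ?ltW//.
  have Jmid : c <= J (2^-1 *: (x + y)) by rewrite linearZ/= linearD; lra.
  have := cD _ (convex_set_midpoint P_convex Px Py) Jmid.
  have := parallelogram ip_norm x y.
  rewrite normrZ exprMn ger0_norm ?invr_ge0// /d in xD yD *.
  lra.
exists k.
  by apply: (closed_cvg _ P_closed _ _ uk); near=> n; case: (uP n).
(* [limr_ge] takes a constant lower bound, so the moving bound M - 1/(n+1) is replaced by M - e,
   with [e] arbitrary. *)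
apply/ler_addgt0Pr => e e0; rewrite -lerBlDr.
have Juk : J (u n) @[n --> \oo] --> J k := cvg_comp _ _ uk (J_continuous k).
rewrite -(cvg_lim _ Juk)//; apply: limr_ge; first by apply/cvg_ex; exists (J k).
near=> n.
have [_ Jn _] := uP n.
have ne : n.+1%:R^-1 < e.
  by near: n; exact: (near_infty_natSinv_lt (PosNum e0)).
by rewrite (le_trans _ Jn)// lerB// ltW.
Unshelve. all: by end_near. Qed.


Theorem proposition4p1 (R : realType) (H : completeNormedModType R)
    (ip : {dot H for idfun}) (ip_norm : induces_norm ip)
    (H_separable : separable H)
    (J : {scalar H}) (J_continuous : continuous J)
    (P : set H) (P_nonempty : P !=set0) (P_bounded : bounded_set P)
    (P_convex : convex_set P) (P_closed : closed P) :
  exists2 k : H, P k & is_max [set J h | h in P] (J k).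
Proof.
have supJ : has_sup [set J h | h in P].
  by split; [exact: image_nonempty|exact: bounded_set_scalar].
have [|k Pk Jk] := closed_convex_slices_meet ip_norm J_continuous P_bounded
    P_convex P_closed (M := sup [set J h | h in P]).
  (* The slice at [c] is nonempty because [c] is the supremum minus the positive gap [e0]. *)
  move=> c cM; have e0 : 0 < sup [set J h | h in P] - c by rewrite subr_gt0.
  have [_ [x Px <-]] := sup_adherent e0 supJ.
  by rewrite subKr => /ltW; exists x.
exists k => //; split; first by exists k.
move=> _ [x Px <-]; apply: le_trans Jk.
by apply: sup_upper_bound => //; exists x.
Qed.
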